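(* Let $\Gamma$ be a finitely generated group, with finite generating set $X$, that contains a nonabelian free group of rank $m$. Then $n^{1/3}\preceq \mathrm{F}_{\Gamma,X}(n)$.
   Context: For a group $\Gamma$ with finite generating set $X$, $\|\cdot\|_X$ denotes word length with respect to $X$. $\mathrm{F}_{\Gamma,X}(n)$ is the smallest positive integer $N$ such that for every nontrivial $\gamma\in\Gamma$ with $\|\gamma\|_X\le n$ there is a normal subgroup of $\Gamma$ of finite index at most $N$ not containing $\gamma$ (and $\mathrm{F}_{\Gamma,X}(n)=\infty$ if there is no such integer). For functions $f_1,f_2$ on the positive integers with values in $[0,\infty]$, $f_1\preceq f_2$ means that there is a constant $C$ (a positive integer) such that $f_1(n)\le C f_2(Cn)$ for all $n\geq 1$. *)

(* Defs.v *)
From mathcomp Require Import all_boot all_order all_algebra.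
From mathcomp Require Import all_classical all_reals all_analysis.

Set Implicit Arguments.
Unset Strict Implicit.
Unset Printing Implicit Defensive.

Import Order.TTheory GRing.Theory Num.Theory.
Local Open Scope classical_set_scope.
Local Open Scope ring_scope.

Section Subgroups.
Variable G : groupType.

Definition is_subgroup (H : set G) : Prop :=
  [/\ H 1%g, (forall x y, H x -> H y -> H (x * y)%g)
    & forall x, H x -> H x^-1%g].

Definition is_normal_subgroup (H : set G) : Prop :=
  is_subgroup H /\ forall x g, H x -> H (x ^ g)%g.

Definition generates (X : set G) : Prop :=
  smallest is_subgroup X = [set: G].

Definition left_coset (H : set G) (g : G) : set G :=
  [set (g * h)%g | h in H].

Definition left_cosets (H : set G) : set (set G) := range (left_coset H).

Definition index_at_most (H : set G) (N : nat) : Prop :=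
  (left_cosets H #<= `I_N)%card.

Definition word_on (X : set G) (w : seq G) : Prop :=
  forall x, x \in w -> X x \/ X (x^-1)%g.

End Subgroups.

Section FreeGroups.

(* The universal property of the free group with basis [b]. *)
Definition is_free_with_basis (F : groupType) (I : Type) (b : I -> F) : Prop :=
  forall (G : groupType) (f : I -> G),
    exists phi : {multiplicative F -> G},
      (forall i, phi (b i) = f i) /\
      forall psi : {multiplicative F -> G},
        (forall i, psi (b i) = f i) -> psi =1 phi.

Definition is_free_of_rank (F : groupType) (m : nat) : Prop :=
  exists b : 'I_m -> F, is_free_with_basis b.

Definition nonabelian (G : groupType) : Prop :=
  exists x y : G, (x * y)%g <> (y * x)%g.

Definition contains_nonabelian_free (G : groupType) (m : nat) : Prop :=
  exists F : groupType,
    [/\ is_free_of_rank F m, nonabelian F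
      & exists iota : {multiplicative F -> G}, injective iota].

End FreeGroups.

Section Growth.
Variable R : realType.

(* The least element of a set of natural numbers, and +oo for the empty set. *)
Definition least (A : set nat) : \bar R :=
  ereal_inf [set (k%:R)%:E | k in A].

Definition word_length (G : groupType) (X : set G) (x : G) : \bar R :=
  least [set k | exists w : seq G,
    [/\ word_on X w, size w = k & (\prod_(y <- w) y)%g = x]].

Definition resid_finite_growth (G : groupType) (X : set G) (n : nat) : \bar R :=
  least [set N | (0 < N)%N /\
    forall x : G, x <> 1%g -> (word_length X x <= (n%:R)%:E)%E ->
      exists H : set G,
        [/\ is_normal_subgroup H, index_at_most H N & ~ H x]].

(* Only the values at positive integers matter. *)
Definition asymp_le (f1 f2 : nat -> \bar R) : Prop :=
  exists2 C : nat, (0 < C)%N &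
    forall n : nat, (1 <= n)%N -> (f1 n <= (C%:R)%:E * f2 (C * n)%N)%E.

End Growth.

(* Main.v *)
Require Import Defs.
From HB Require Import structures.
From mathcomp Require Import all_boot all_order all_algebra.
From mathcomp Require Import all_classical all_reals all_analysis.
From mathcomp Require Import zify.

(** Let a, b be two elements of a basis of the free group.  A balanced binary
tree of commutators of conjugates of a, a^2, ..., a^(2^d) yields an element w,
of length O(8^d), which lies in the normal closure of each of these powers; in
the free group it is nontrivial.  In a quotient with at most 2^d elements some
a^j with 0 < j <= 2^d dies, hence so does w.  Thus F(C 8^d) > 2^d.  The
nontriviality of w is checked by ping-pong in a group of permutations of the
set of words in four letters. *)

Set Implicit Arguments.
Unset Strict Implicit.
Unset Printing Implicit Defensive.

Import Order.TTheory GRing.Theory Num.Theory.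
Local Open Scope nat_scope.

(** * The group of all bijections of a type *)

Section Symmetric.
Variable T : Type.

Record symmetry := Symmetry {
  fwd : T -> T;
  bwd : T -> T;
  fwdK : cancel fwd bwd;
  bwdK : cancel bwd fwd }.

Lemma symmetry_eq (f g : symmetry) : fwd f =1 fwd g -> f = g.
Proof.
case: f g => [f f' fK f'K] [g g' gK g'K] /= /funext efg.
subst g; have efg' : f' = g' by apply/funext => x; rewrite -[x in LHS]g'K fK.
by subst g'; congr Symmetry; exact: Prop_irrelevance.
Qed.

Definition symmetry_one : symmetry :=
  @Symmetry id id (fun=> erefl) (fun=> erefl).
Definition symmetry_inv (f : symmetry) : symmetry := Symmetry (bwdK f) (fwdK f).
Definition symmetry_mul (f g : symmetry) : symmetry :=
  Symmetry (can_comp (fwdK f) (fwdK g)) (can_comp (bwdK g) (bwdK f)).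

HB.instance Definition _ := gen_eqMixin symmetry.
HB.instance Definition _ := gen_choiceMixin symmetry.

Fact symmetry_mulA : associative symmetry_mul.
Proof. by move=> f g h; apply: symmetry_eq. Qed.
Fact symmetry_mul1 : left_id symmetry_one symmetry_mul.
Proof. by move=> f; apply: symmetry_eq. Qed.
Fact symmetry_mulr1 : right_id symmetry_one symmetry_mul.
Proof. by move=> f; apply: symmetry_eq. Qed.
Fact symmetry_mulV : left_inverse symmetry_one symmetry_inv symmetry_mul.
Proof. by move=> f; apply: symmetry_eq => x /=; rewrite fwdK. Qed.
Fact symmetry_mulrV : right_inverse symmetry_one symmetry_inv symmetry_mul.
Proof. by move=> f; apply: symmetry_eq => x /=; rewrite bwdK. Qed.

HB.instance Definition _ := isGroup.Build symmetry symmetry_mulA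
  symmetry_mul1 symmetry_mulr1 symmetry_mulV symmetry_mulrV.

End Symmetric.

(** The leaves are the conjugates by [y] of [x ^+ s], ..., [x ^+ (s + 2 ^ d - 1)]. Conjugating the
    two subtrees by different elements prevents cancellation in the commutator. *)
Fixpoint comm_tree (G : groupType) (x y : G) (d s : nat) : G :=
  (if d is d'.+1 then
    [~ comm_tree x y d' s ^ x, comm_tree x y d' (s + 2 ^ d')%N ^ y]
  else (x ^+ s) ^ y)%g.

Lemma comm_tree_morph (G H : groupType) (f : {multiplicative G -> H})
  (x y : G) (d s : nat) :
  f (comm_tree x y d s) = comm_tree (f x) (f y) d s.
Proof.
(* [f] only records compatibility with products. It preserves [1] by cancellation and is repackaged
   with this fact, so that the rules for powers, conjugates and commutators apply. *)
suff treef (h : UMagmaMorphism.type G H) :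
    h (comm_tree x y d s) = comm_tree (h x) (h y) d s.
  have f1 : f 1%g = 1%g by apply: (@mulgI _ (f 1%g)); rewrite -gmulfM !mulg1.
  exact: (treef (HB.pack (f : G -> H)
    (isUMagmaMorphism.Build G H f (f1, @gmulfM _ _ f)))).
elim: d s => [|d IHd] s /=; first by rewrite gmulfJ gmulfXn.
by rewrite gmulfR !gmulfJ !IHd.
Qed.

(** * Ping-pong on words in four letters *)

Section PingPong.

(* The second component tells whether the letter is inverted. *)
Definition letter := (bool * bool)%type.
Definition inv_letter (l : letter) : letter := (l.1, ~~ l.2).

Lemma inv_letterK : involutive inv_letter.
Proof. by case=> a b; rewrite /inv_letter negbK. Qed.

Lemma inv_letter_neq (l : letter) : inv_letter l != l.
Proof. by case: l => [[] []]. Qed.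

(* Left multiplication by [l] on reduced words, extended to a bijection of the
set of all words by exchanging the prefixes [l^-1 l] and [l l^-1]. *)
Definition push (l : letter) (w : seq letter) : seq letter :=
  if w is c :: w' then
    if c == inv_letter l then
      if w' is e :: w'' then
        if e == l then l :: inv_letter l :: w'' else w'
      else w'
    else l :: w
  else [:: l].

Lemma pushK (l : letter) : cancel (push l) (push (inv_letter l)).
Proof.
move=> [|c w] /=; first by rewrite inv_letterK eqxx.
case: eqP => [->|/eqP cl]; last first.
  by rewrite /= inv_letterK eqxx (negPf cl).
case: w => [|e w] //=.
case: ifP => [/eqP-> |el] /=; first by rewrite inv_letterK !eqxx.
by rewrite inv_letterK el.
Qed.

Lemma push_invK (l : letter) : cancel (push (inv_letter l)) (push l).
Proof. by move=> w; rewrite -{1}[l]inv_letterK pushK. Qed.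

Definition perm_letter (l : letter) : symmetry (seq letter) :=
  Symmetry (pushK l) (push_invK l).

Definition starts (l : letter) (w : seq letter) : bool := ohead w == Some l.

Lemma starts_inj (k l : letter) (w : seq letter) :
  k != l -> starts k w -> ~~ starts l w.
Proof. by rewrite /starts => kl /eqP->. Qed.

(** Models left multiplication by a reduced word with first letter [a] and last letter
    [inv_letter b]. *)
Definition ping_pong (u : symmetry (seq letter)) (a b : letter) : Prop :=
  (forall w, ~~ starts b w -> starts a (fwd u w)) /\
  (forall w, ~~ starts a w -> starts b (bwd u w)).

Lemma starts_push (l : letter) (w : seq letter) :
  ~~ starts (inv_letter l) w -> starts l (push l w).
Proof.
rewrite /starts; case: w => [|c w] /=; first by rewrite eqxx.
by rewrite (inj_eq Some_inj) => /negPf-> /=.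
Qed.

Lemma ping_pong_letter (l : letter) :
  ping_pong (perm_letter l) l (inv_letter l).
Proof.
split=> w /=; first exact: starts_push.
by rewrite -{1}[l]inv_letterK; exact: starts_push.
Qed.

(** The condition [b != c] says that nothing cancels where [u] meets [v]. *)
Lemma ping_pongM u v a b c e :
  b != c -> ping_pong u a b -> ping_pong v c e -> ping_pong (u * v)%g a e.
Proof.
move=> bc [u1 u2] [v1 v2]; split=> w sw /=.
  by apply/u1/(starts_inj _ (v1 _ sw)); rewrite eq_sym.
by apply/v2/(starts_inj bc)/u2.
Qed.

Lemma ping_pongV u a b : ping_pong u a b -> ping_pong u^-1%g b a.
Proof. by case. Qed.

Lemma ping_pongX l n :
  ping_pong (perm_letter l ^+ n.+1)%g l (inv_letter l).
Proof.
elim: n => [|n IHn]; first by rewrite expg1; exact: ping_pong_letter.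
rewrite expgS; apply: ping_pongM IHn; last exact: ping_pong_letter.
exact: inv_letter_neq.
Qed.

(** Both ends come to depend on [l] alone, so conjugates by different letters satisfy the hypotheses
    of [ping_pongR]. *)
Lemma ping_pongJ u a b l : a != l -> b != l -> ping_pong u a b ->
  ping_pong (u ^ perm_letter l)%g (inv_letter l) (inv_letter l).
Proof.
move=> al bl puab; apply: (@ping_pongM _ _ _ l a); first by rewrite eq_sym.
  exact/ping_pongV/ping_pong_letter.
exact: ping_pongM bl puab (ping_pong_letter _).
Qed.

Lemma ping_pongR u v a b : a != b -> ping_pong u a a -> ping_pong v b b ->
  ping_pong [~ u, v]%g a b.
Proof.
move=> ab pu pv; apply: (ping_pongM ab (ping_pongV pu)).
by apply: (ping_pongM _ (ping_pongV pv) (ping_pongM ab pu pv)); rewrite eq_sym.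
Qed.

(** The empty word starts with no letter, but its image starts with [a]. *)
Lemma ping_pong_neq1 u a b : ping_pong u a b -> u <> 1%g.
Proof. by move=> [/(_ [::] isT) + _] u1; rewrite u1. Qed.

Lemma comm_tree_perm_neq1 (k l : letter) (d s : nat) :
  k != l -> inv_letter k != l -> (0 < s)%N ->
  comm_tree (perm_letter k) (perm_letter l) d s <> 1%g.
Proof.
move=> kl Kl s0.
have lk : l != k by rewrite eq_sym.
have Lk : inv_letter l != k.
  by rewrite -(inj_eq (inv_inj inv_letterK)) inv_letterK eq_sym.
have KL : inv_letter k != inv_letter l.
  by rewrite (inj_eq (inv_inj inv_letterK)).
(* The induction also keeps both ends away from [k] and [l], as conjugation by either letter at the
   next level requires. *)
suff [a [b [_ _ _ _ /ping_pong_neq1]]] : exists a b,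
  [/\ a != k, a != l, b != k, b != l &
      ping_pong (comm_tree (perm_letter k) (perm_letter l) d s) a b] by [].
elim: d s s0 => [|d IHd] s s0 /=.
  case: s s0 => // s _; exists (inv_letter l), (inv_letter l).
  split=> //; try exact: inv_letter_neq.
  by apply: ping_pongJ (ping_pongX k s).
have [a1 [b1 [a1k _ b1k _ p1]]] := IHd _ s0.
have [|a2 [b2 [_ a2l _ b2l p2]]] := IHd (s + 2 ^ d)%N.
  by rewrite addn_gt0 s0.
exists (inv_letter k), (inv_letter l); split=> //; try exact: inv_letter_neq.
by apply: ping_pongR KL (ping_pongJ a1k b1k p1) (ping_pongJ a2l b2l p2).
Qed.

End PingPong.

(* If the basis elements commuted pairwise then conjugation by a basis element,
and then conjugation by an arbitrary element, would fix the basis. *)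
Lemma free_noncommuting_basis (F : groupType) (I : Type) (b : I -> F) :
  is_free_with_basis b -> nonabelian F ->
  exists i j, (b i * b j)%g <> (b j * b i)%g.
Proof.
move=> freeF [x [y xy]]; apply: contrapT => commb.
have bC i j : commute (b i) (b j).
  by apply: contrapT => bij; apply: commb; exists i, j.
have central g : (forall i, commute (b i) g) -> forall z, commute z g.
  move=> bg z; have [phi [_ phiU]] := freeF F b.
  pose cg : {multiplicative F -> F} :=
    HB.pack (fun u : F => u ^ g)%g (isMultiplicative.Build F F
      (fun u : F => u ^ g)%g (fun u v => conjMg u v g)).
  have e1 : cg =1 phi.
    by apply: phiU => i /=; apply/conjg_fixP/eqP/eqP/commgP/bg.
  have e2 : (idfun : {multiplicative F -> F}) =1 phi by apply: phiU.
  by apply/commgP; rewrite -conjg_fix; apply/eqP; rewrite -[RHS]/(idfun z) e2 -e1.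
by apply: xy; apply: (central) => i; apply/esym/central => j; exact: bC.
Qed.

Lemma comm_tree_free_neq1 (F : groupType) (m : nat) : is_free_of_rank F m ->
  nonabelian F -> exists x y : F, forall d s, (0 < s)%N ->
    comm_tree x y d s <> 1%g.
Proof.
move=> [b freeb] /(free_noncommuting_basis freeb)[i [j bij]].
have ij : i != j by apply/eqP => eij; apply: bij; rewrite eij.
exists (b i), (b j) => d s s0 tree1.
(* Only the images of [b i] and [b j] matter; all basis elements other than [b i] may share one
   letter. *)
have [phi [phib _]] :=
  freeb (symmetry (seq letter)) (fun k => perm_letter (k == i, false)).
apply: (@comm_tree_perm_neq1 (true, false) (false, false) d s) => //.
have := comm_tree_morph phi (b i) (b j) d s.
rewrite tree1 !phib eqxx eq_sym (negPf ij) => <-.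
by apply: (@mulgI _ (phi 1%g)); rewrite -gmulfM !mulg1.
Qed.

(** * Normal subgroups and subgroups of bounded index *)

Section NormalSubgroups.
Variable G : groupType.

(** A normal subgroup containing one entry of a commutator contains the commutator, so membership
    climbs from the leaf of exponent [j] to the root. *)
Lemma comm_tree_mem (H : set G) (x y : G) (d s j : nat) :
  is_normal_subgroup H -> (s <= j < s + 2 ^ d)%N -> H (x ^+ j)%g ->
  H (comm_tree x y d s).
Proof.
move=> [[H1 HM HV] HJ] + Hj; elim: d s => [|d IHd] s /= sj.
  by apply: HJ; have -> : s = j by lia.
have [jlt|jge] := ltnP j (s + 2 ^ d).
  rewrite commgEl; have Hu := HJ _ x (IHd s ltac:(lia)).
  by apply: HM; [exact: HV | exact: HJ].
have Hv := HJ _ y (IHd (s + 2 ^ d) ltac:(rewrite expnS in sj; lia)).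
by rewrite commgEr; apply: HM => //; apply/HJ/HV.
Qed.

(** Pigeonhole: two of the [N.+1] cosets of [x ^+ 0], ..., [x ^+ N] coincide. *)
Lemma index_at_most_expg (H : set G) (N : nat) (x : G) :
  is_subgroup H -> index_at_most H N ->
  exists2 j, (0 < j <= N)%N & H (x ^+ j)%g.
Proof.
move=> [H1 HM HV] HN; apply: contrapT => noj.
have powI i j : (i < j <= N)%N ->
    left_coset H (x ^+ i)%g = left_coset H (x ^+ j)%g -> False.
  move=> ij eij; have : left_coset H (x ^+ i)%g (x ^+ j)%g.
    by rewrite eij; exists 1%g => //; rewrite mulg1.
  move=> [h Hh hj]; apply: noj; exists (j - i)%N; first by lia.
  suff -> : (x ^+ (j - i) = h)%g by [].
  by apply: (@mulgI _ (x ^+ i)%g); rewrite hj -expgnDr subnKC //; lia.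
have inj : {in `I_N.+1 &, injective (fun i => left_coset H (x ^+ i)%g)}%classic.
  move=> i j; rewrite !inE /= => iN jN eij.
  case: (ltngtP i j) => // ij; exfalso.
    by apply: (powI i j) eij; lia.
  by apply: (powI j i) (esym eij); lia.
have /card_le_trans/(_ HN) :
    (((fun i => left_coset H (x ^+ i)%g) @` `I_N.+1) #<= left_cosets H)%classic%card.
  by apply: subset_card_le => _ [i _ <-]; exists (x ^+ i)%g.
rewrite (card_le_eql (inj_card_eq inj)) card_le_II; lia.
Qed.

End NormalSubgroups.

(** * Word length of the commutator tree *)

Section WordBalls.
Variables (G : groupType) (X : set G).

Definition word_ball (k : nat) (g : G) : Prop := exists w : seq G,
  [/\ word_on X w, (size w <= k)%N & (\prod_(y <- w) y)%g = g].

Lemma word_ballM j k g h :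
  word_ball j g -> word_ball k h -> word_ball (j + k) (g * h)%g.
Proof.
move=> [v [vX vj <-]] [w [wX wk <-]]; exists (v ++ w); split.
- by move=> x; rewrite mem_cat => /orP[/vX|/wX].
- by rewrite size_cat leq_add.
- by rewrite big_cat.
Qed.

Lemma word_ballV k g : word_ball k g -> word_ball k g^-1%g.
Proof.
move=> [w [wX wk <-]]; exists (rev [seq y^-1%g | y <- w]); split.
- move=> x; rewrite mem_rev => /mapP[y /wX yX ->]; rewrite invgK.
  by case: yX => ?; [right | left].
- by rewrite size_rev size_map.
- elim: w {wX wk} => [|y w IHw]; first by rewrite !big_nil invg1.
  by rewrite big_cons invgM -IHw map_cons rev_cons -cats1 big_cat big_seq1.
Qed.

Lemma word_ball_le j k g : (j <= k)%N -> word_ball j g -> word_ball k g.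
Proof. by move=> jk [w [wX wj <-]]; exists w; split=> //; exact: leq_trans jk. Qed.

Lemma word_ball1 : word_ball 0 1%g.
Proof. by exists [::]; split=> //; rewrite big_nil. Qed.

Lemma word_ballX k g n : word_ball k g -> word_ball (n * k) (g ^+ n)%g.
Proof.
move=> gk; elim: n => [|n IHn]; first exact: word_ball1.
by rewrite expgS mulSn; exact: word_ballM.
Qed.

Lemma word_ballJ j k g h :
  word_ball j g -> word_ball k h -> word_ball (j + 2 * k) (g ^ h)%g.
Proof.
move=> gj hk; apply: (@word_ball_le (k + (j + k))); first by lia.
exact: word_ballM (word_ballV hk) (word_ballM gj hk).
Qed.

Lemma word_ballR j k g h :
  word_ball j g -> word_ball k h -> word_ball (2 * (j + k)) [~ g, h]%g.
Proof.
move=> gj hk; apply: (@word_ball_le (j + (k + (j + k)))); first by lia.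
exact: word_ballM (word_ballV gj) (word_ballM (word_ballV hk) (word_ballM gj hk)).
Qed.

Lemma generates_word_ball g : generates X -> exists k, word_ball k g.
Proof.
move=> genX; have : [set: G]%classic g by [].
rewrite -genX; apply: (@smallest_sub _ _ _ [set g | exists k, word_ball k g]%classic).
  split=> [|x y [j xj] [k yk]|x [k xk]].
  - by exists 0%N; exact: word_ball1.
  - by exists (j + k)%N; exact: word_ballM.
  - by exists k; exact: word_ballV.
move=> x xX; exists 1%N, [:: x]; split=> //; last by rewrite big_seq1.
by move=> y; rewrite inE => /eqP->; left.
Qed.

(** In units of [k], subtrees of lengths [p] and [q] give length [2 * (p + q) + 8]. The term [- 3]
    absorbs the constant, as twice [- 6] plus [8] is [- 4]; at depth [0] the bound is the exact cost
    [s + 2]. *)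
Lemma word_ball_comm_tree (x y : G) (k d s : nat) :
  word_ball k x -> word_ball k y ->
  word_ball (k * (4 ^ d * (s + 2 ^ d + 4) - 3)) (comm_tree x y d s).
Proof.
move=> xk yk; elim: d s => [|d IHd] s.
  apply: word_ball_le (word_ballJ (word_ballX s xk) yk).
  by rewrite /= !expn0; nia.
apply: word_ball_le
  (word_ballR (word_ballJ (IHd s) xk) (word_ballJ (IHd (s + 2 ^ d)) yk)).
(* Positivity of [4 ^ d] keeps the subtraction of [3] from truncating. *)
have := expn_gt0 4 d; rewrite /= !expnS => p4.
nia.
Qed.

End WordBalls.

(** * The lower bound for the growth function *)

Section Growth.
Variable R : realType.

Lemma word_ball_length (G : groupType) (X : set G) (k : nat) (g : G) :
  word_ball X k g -> (word_length R X g <= (k%:R)%:E)%E.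
Proof.
move=> [w [wX wk wg]].
apply: (@le_trans _ _ ((size w)%:R%:E)%E); last by rewrite lee_fin ler_nat.
by apply: ereal_inf_lbound; exists (size w) => //; exists w.
Qed.

(** If an admissible [N] were below [2 ^ d], the subgroup avoiding the tree would contain some
    [x ^+ j] with [0 < j <= N]. Starting the leaves at exponent [1] makes this a leaf power, so the
    subgroup would contain the tree. *)
Lemma resid_finite_growth_ge (G : groupType) (X : set G) (x y : G) (d n : nat) :
  comm_tree x y d 1 <> 1%g -> word_ball X n (comm_tree x y d 1) ->
  (((2 ^ d)%N%:R)%:E <= resid_finite_growth R X n)%E.
Proof.
move=> tree1 treen; apply: le_ereal_inf_tmp => _ [N [N0 HN] <-].
rewrite lee_fin ler_nat leqNgt; apply/negP => Nd.
have [H [nH HNi]] := HN _ tree1 (word_ball_length treen).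
have [j jN Hj] := index_at_most_expg x nH.1 HNi.
by case; apply: comm_tree_mem nH _ Hj; lia.
Qed.

Lemma cbrt_le (n d : nat) : (n <= 8 ^ d)%N ->
  ((n%:R : R) `^ (3%:R^-1 : R) <= (2 ^ d)%N%:R)%R.
Proof.
move=> nd.
have -> : ((2 ^ d)%N%:R = ((8 ^ d)%N%:R : R) `^ 3%:R^-1)%R.
  have -> : ((8 ^ d)%N = (2 ^ d) ^ 3)%N by rewrite -expnM mulnC expnM.
  by rewrite (natrX _ (2 ^ d) 3) -(powR_mulrn 3) ?ler0n// -powRrM divff ?pnatr_eq0// powRr1.
by apply: ge0_ler_powR; rewrite ?nnegrE ?ler0n ?invr_ge0 ?ler_nat.
Qed.

End Growth.

Theorem theorem1p2 (R : realType) (Gamma : groupType) (X : set Gamma)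
  (finX : finite_set X) (genX : generates X)
  (m : nat) (freeG : contains_nonabelian_free Gamma m) :
  asymp_le (fun n : nat => ((n%:R : R) `^ (3%:R^-1 : R))%R%:E)
           (resid_finite_growth R X).
Proof.
have [F [freeF nabF [iota iotaI]]] := freeG.
have [x [y treeF]] := comm_tree_free_neq1 freeF nabF.
have [k1 xk] := generates_word_ball (iota x) genX.
have [k2 yk] := generates_word_ball (iota y) genX.
(* With [8 ^ d <= n < 8 ^ d.+1], the tree has length at most [6 * k * 8 ^ d], hence at most [C * n].
   The summand [2] pays for the step from [2 ^ d] to [2 ^ d.+1], which bounds the cube root of
   [n]. *)
pose k := k1 + k2; pose C := 6 * k + 2.
exists C => [|n n0]; first by rewrite /C; lia.
have /andP[dn nd] := @trunc_log_bounds 8 n isT n0.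
set d := trunc_log 8 n in dn nd.
have tree1 : comm_tree (iota x) (iota y) d 1 <> 1%g.
  rewrite -comm_tree_morph => it1; apply: (treeF d 1 isT); apply: iotaI.
  by rewrite it1; apply: (@mulgI _ (iota 1%g)); rewrite -gmulfM !mulg1.
have treen : word_ball X (C * n) (comm_tree (iota x) (iota y) d 1).
  apply: word_ball_le (word_ball_comm_tree (k := k) d 1 _ _);
    [|by apply: word_ball_le xk; rewrite leq_addr
     |by apply: word_ball_le yk; rewrite leq_addl].
  have e8 : 8 ^ d = 4 ^ d * 2 ^ d by rewrite -expnMn.
  have p2 := expn_gt0 2 d.
  have : 4 ^ d * (1 + 2 ^ d + 4) <= 6 * 8 ^ d by nia.
  rewrite /C; nia.
have lowd := resid_finite_growth_ge R tree1 treen.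
apply: (@le_trans _ _ ((C%:R)%:E * ((2 ^ d)%N%:R)%:E)%E).
  rewrite -EFinM lee_fin -natrM.
  apply: (le_trans (cbrt_le R (ltnW nd))).
  by rewrite ler_nat expnS leq_mul2r /C; lia.
by apply: lee_wpmul2l => //; rewrite lee_fin ler0n.
Qed.
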